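(* Consider the contextual search problem in dimension $d=2$ with the symmetric loss $\ell(\theta,p)=|\theta-p|$, and let the learner use the 2D-SymmetricSearch rule described in the context. Then for every horizon $T$, every hidden point $v\in[0,1]^2$ and every (possibly adaptive) choice of contexts by the adversary, the total loss $\sum_{t=1}^T |\langle u_t,v\rangle-p_t|$ is at most $8+2\sqrt{2}$.
   Context: Contextual search problem in dimension $d$: an adversary fixes $v\in[0,1]^d$. In each round $t=1,\dots,T$ the adversary chooses a unit vector $u_t\in\mathbb{R}^d$, the learner chooses $p_t\in\mathbb{R}$, incurs loss $\ell(\langle u_t,v\rangle,p_t)$, and learns the sign of $\langle u_t,v\rangle-p_t$ (i.e. whether $p_t\le\langle u_t,v\rangle$ or $p_t\ge \langle u_t,v\rangle$). The learner keeps a knowledge set: $S_1=[0,1]^d$, and $S_{t+1}=S_t^+(p_t;u_t):=\{x\in S_t:\langle u_t,x\rangle\ge p_t\}$ if it learned $p_t\le\langle u_t,v\rangle$, and $S_{t+1}=S_t^-(p_t;u_t):=\{x\in S_t:\langle u_t,x\rangle\le p_t\}$ otherwise. Let $\underline p_t=\min_{x\in S_t}\langle u_t,x\rangle$ and $\overline p_t=\max_{x\in S_t}\langle u_t,x\rangle$. 2D-SymmetricSearch ($d=2$): set $w=\frac12(\overline p_t-\underline p_t)$, $p^{\mathrm{mid}}_t=\frac12(\overline p_t+\underline p_t)$, and let $h$ be the length of the segment $S_t\cap\{x:\langle u_t,x\rangle=p^{\mathrm{mid}}_t\}$. If $w\ge h$, guess $p_t=p^{\mathrm{mid}}_t$;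 otherwise guess $p_t$ such that $S_t^+(p_t;u_t)$ and $S_t^-(p_t;u_t)$ have equal area. *)

(* Defs.v *)
From HB Require Import structures.
From mathcomp Require Import all_boot all_order all_algebra.
From mathcomp Require Import all_classical all_reals all_analysis.
Set Implicit Arguments.
Unset Strict Implicit.
Unset Printing Implicit Defensive.
Import Order.TTheory GRing.Theory Num.Theory.
Local Open Scope classical_set_scope.
Local Open Scope ring_scope.

(* Points and contexts of the plane are pairs.  The Euclidean structure is
   spelled out because the library norm on [R * R] is the max norm. *)
Definition dot (R : realType) (x y : R * R) : R := x.1 * y.1 + x.2 * y.2.

Definition enorm (R : realType) (x : R * R) : R := Num.sqrt (dot x x).

Definition unit_square (R : realType) : set (R * R) :=
  [set x | [/\ 0 <= x.1, x.1 <= 1, 0 <= x.2 & x.2 <= 1]].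

Definition area (R : realType) (A : set (R * R)) : \bar R :=
  ((@lebesgue_measure R) \x (@lebesgue_measure R))%E A.

Definition segment (R : realType) (a b : R * R) : set (R * R) :=
  [set ((1 - s) * a.1 + s * b.1, (1 - s) * a.2 + s * b.2) | s in `[0, 1]].

(* The endpoints of a segment are unique up to swapping, so the value does not
   depend on the choice; 0 is a junk value when [A] is not a segment. *)
Definition segment_length (R : realType) (A : set (R * R)) : R :=
  xget 0 [set h | exists a b : R * R,
            A = segment a b /\ h = enorm (b.1 - a.1, b.2 - a.2)].

Definition upper_part (R : realType) (S : set (R * R)) (u : R * R) (p : R) :
  set (R * R) := [set x | S x /\ p <= dot u x].

Definition lower_part (R : realType) (S : set (R * R)) (u : R * R) (p : R) :
  set (R * R) := [set x | S x /\ dot u x <= p].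

(* Knowledge sets are nonempty and compact, so these are a min and a max. *)
Definition p_low (R : realType) (S : set (R * R)) (u : R * R) : R :=
  inf [set dot u x | x in S].

Definition p_high (R : realType) (S : set (R * R)) (u : R * R) : R :=
  sup [set dot u x | x in S].

Definition half_width (R : realType) (S : set (R * R)) (u : R * R) : R :=
  (p_high S u - p_low S u) / 2.

Definition p_mid (R : realType) (S : set (R * R)) (u : R * R) : R :=
  (p_high S u + p_low S u) / 2.

Definition mid_chord_length (R : realType) (S : set (R * R)) (u : R * R) : R :=
  segment_length (S `&` [set x | dot u x = p_mid S u]).

Definition symmetric_search_2d (R : realType) (S : set (R * R)) (u : R * R)
    (p : R) : Prop :=
  if mid_chord_length S u <= half_width S u then p = p_mid S u
  else area (upper_part S u p) = area (lower_part S u p).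

(* [b = true] reports [p <= <u, v>] and [b = false] reports [p >= <u, v>];
   when [p = <u, v>] both answers are allowed. *)
Definition truthful (R : realType) (v u : R * R) (p : R) (b : bool) : Prop :=
  if b then p <= dot u v else dot u v <= p.

(* Rounds are numbered from 0. *)
Fixpoint knowledge (R : realType) (u : nat -> R * R) (p : nat -> R)
    (b : nat -> bool) (t : nat) : set (R * R) :=
  match t with
  | 0%N => unit_square (R := R)
  | t'.+1 => let S := knowledge u p b t' in
             if b t' then upper_part S (u t') (p t')
             else lower_part S (u t') (p t')
  end.

(* Main.v *)
(* Write H for the sum of the side lengths of the bounding box of the knowledge
   set S (initially 2) and A for its area (initially 1).  Every round loses at
   most the decrease of 2 H + (4 + 2 sqrt 2) sqrt A.  Let w be the half-width
   and h the middle chord of S in direction u.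
   - If w >= h, the loss is at most w, and H drops by at least w / 2: seen from
     an extreme point of the removed side, whatever remains lies behind the
     middle chord, which is too short to keep both box sides facing that point
     in place.  Thus H does the work usually done by the perimeter.
   - If w < h, the loss is at most 2 w, and S contains a kite with diagonals h
     and 2 w, so w ^ 2 <= A; since A is halved, (4 + 2 sqrt 2) sqrt A drops by
     2 sqrt A >= 2 w.
   The knowledge set keeps three non-collinear points, which forces the
   equal-area guess to lie strictly inside the range of <u, .> on S. *)
Require Import Defs.
From mathcomp Require Import all_boot all_order all_algebra.
From mathcomp Require Import all_classical all_reals all_analysis.
From mathcomp Require Import measurable_realfun ring lra.
Set Implicit Arguments.
Unset Strict Implicit.
Unset Printing Implicit Defensive.
Import Order.TTheory GRing.Theory Num.Theory.
Import numFieldNormedType.Exports.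
Local Open Scope classical_set_scope.
Local Open Scope ring_scope.

(** * Dot products, reversal of the context and convexity in the plane *)

Definition opp2 (R : realType) (u : R * R) : R * R := (- u.1, - u.2).

Definition between (R : realType) (s : R) (a b : R * R) : R * R :=
  ((1 - s) * a.1 + s * b.1, (1 - s) * a.2 + s * b.2).

Definition convex2 (R : realType) (S : set (R * R)) : Prop :=
  forall a b (s : R), S a -> S b -> 0 <= s <= 1 -> S (between s a b).

Lemma dot_between (R : realType) (u a b : R * R) (s : R) :
  dot u (between s a b) = (1 - s) * dot u a + s * dot u b.
Proof. by rewrite /dot /between /=; ring. Qed.

Lemma dot_opp2 (R : realType) (u x : R * R) : dot (opp2 u) x = - dot u x.
Proof. by rewrite /dot /opp2 /=; ring. Qed.

Lemma enorm1E (R : realType) (u : R * R) :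
  enorm u = 1 -> u.1 ^+ 2 + u.2 ^+ 2 = 1.
Proof.
rewrite /enorm /dot -!expr2 => h.
by rewrite -[LHS]sqr_sqrtr ?addr_ge0 ?sqr_ge0// h expr1n.
Qed.

Lemma dot_continuous (R : realType) (u : R * R) : continuous (dot u).
Proof.
move=> x; apply: cvgD; apply: cvgM; try exact: cvg_cst.
- exact: cvg_fst.
- exact: cvg_snd.
Qed.

Section extreme_values.
Context {R : realType} {S : set (R * R)} (u : R * R).
Hypotheses (cS : compact S).

Lemma p_high_max : S !=set0 ->
  exists2 x, S x & forall y, S y -> dot u y <= dot u x.
Proof.
move=> S0; have [|x xS xmax] := compact_EVT_max (f := dot u) S0 cS.
  exact/continuous_subspaceT/dot_continuous.
by exists x => [|y yS]; [exact: set_mem | exact/xmax/mem_set].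
Qed.

Lemma p_low_min : S !=set0 ->
  exists2 x, S x & forall y, S y -> dot u x <= dot u y.
Proof.
move=> S0; have [|x xS xmin] := compact_EVT_min (f := dot u) S0 cS.
  exact/continuous_subspaceT/dot_continuous.
by exists x => [|y yS]; [exact: set_mem | exact/xmin/mem_set].
Qed.

Lemma le_p_high x : S x -> dot u x <= p_high S u.
Proof.
move=> Sx; have [|z Sz zmax] := p_high_max; first by exists x.
by apply: ub_le_sup; [exists (dot u z) => _ [y /zmax ? <-] | exists x].
Qed.

Lemma ge_p_low x : S x -> p_low S u <= dot u x.
Proof.
move=> Sx; have [|z Sz zmin] := p_low_min; first by exists x.
by apply: ge_inf; [exists (dot u z) => _ [y /zmin ? <-] | exists x].
Qed.

Lemma p_high_attained : S !=set0 -> exists2 x, S x & dot u x = p_high S u.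
Proof.
move=> S0; have [x Sx xmax] := p_high_max S0; exists x => //.
apply/eqP; rewrite eq_le le_p_high//=; apply: ge_sup.
  by exists (dot u x), x.
by move=> _ [y /xmax ? <-].
Qed.

Lemma p_low_attained : S !=set0 -> exists2 x, S x & dot u x = p_low S u.
Proof.
move=> S0; have [x Sx xmin] := p_low_min S0; exists x => //.
apply/eqP; rewrite eq_le ge_p_low// andbT; apply: lb_le_inf.
  by exists (dot u x), x.
by move=> _ [y /xmin ? <-].
Qed.

End extreme_values.

Lemma p_low_opp2 (R : realType) (S : set (R * R)) (u : R * R) :
  p_low S (opp2 u) = - p_high S u.
Proof.
rewrite /p_low /inf /p_high; congr (- sup _).
apply/seteqP; split => [_ [_ [y Sy <-] <-]|_ [y Sy <-]].
  by exists y => //; rewrite dot_opp2 opprK.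
by exists (dot (opp2 u) y); [exists y | rewrite dot_opp2 opprK].
Qed.

Lemma opp2K (R : realType) (u : R * R) : opp2 (opp2 u) = u.
Proof. by case: u => x y; rewrite /opp2 /= !opprK. Qed.

Lemma p_high_opp2 (R : realType) (S : set (R * R)) (u : R * R) :
  p_high S (opp2 u) = - p_low S u.
Proof. by rewrite -[in RHS](opp2K u) p_low_opp2 opprK. Qed.

Lemma half_width_opp2 (R : realType) (S : set (R * R)) (u : R * R) :
  half_width S (opp2 u) = half_width S u.
Proof.
by rewrite /half_width p_low_opp2 p_high_opp2 opprK; congr (_ / _); ring.
Qed.

Lemma p_mid_opp2 (R : realType) (S : set (R * R)) (u : R * R) :
  p_mid S (opp2 u) = - p_mid S u.
Proof. by rewrite /p_mid p_low_opp2 p_high_opp2; lra. Qed.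

(** With the other facts on [opp2], this reduces every round to one whose answer keeps the lower
    part. *)
Lemma upper_part_opp2 (R : realType) (S : set (R * R)) (u : R * R) p :
  upper_part S u p = lower_part S (opp2 u) (- p).
Proof.
by apply/seteqP; split => x; rewrite /upper_part /lower_part/= dot_opp2 lerN2.
Qed.

Lemma closed_lower_part (R : realType) (u : R * R) (p : R) :
  closed [set x | dot u x <= p].
Proof.
apply: (@preimage_closed _ _ (dot u) [set y | y <= p]) => [x _|].
  exact: dot_continuous.
exact: closed_le.
Qed.

Lemma compact_lower_part {R : realType} (S : set (R * R)) u p :
  compact S -> compact (lower_part S u p).
Proof.
by move=> cS; apply: compact_closedI => //; exact: closed_lower_part.
Qed.

Lemma compact_upper_part {R : realType} (S : set (R * R)) u p :
  compact S -> compact (upper_part S u p).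
Proof. by move=> cS; rewrite upper_part_opp2; exact: compact_lower_part. Qed.

Lemma convex2_lower_part {R : realType} (S : set (R * R)) u p :
  convex2 S -> convex2 (lower_part S u p).
Proof.
move=> vS a b s [Sa ap] [Sb bp] s01; split; first exact: vS.
by rewrite dot_between; nra.
Qed.

Lemma convex2_upper_part {R : realType} (S : set (R * R)) u p :
  convex2 S -> convex2 (upper_part S u p).
Proof. by rewrite upper_part_opp2; exact: convex2_lower_part. Qed.

(** * Shrinking of the bounding box under a midpoint cut *)

(** Twice a half-width is a side length, so this is half the perimeter of the bounding box. *)
Definition box_width (R : realType) (S : set (R * R)) : R :=
  2 * (half_width S (1, 0) + half_width S (0, 1)).

Lemma half_width_subset {R : realType} (S L : set (R * R)) u :
  compact S -> compact L -> L !=set0 -> L `<=` S ->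
  half_width L u <= half_width S u.
Proof.
move=> cS cL L0 LS; rewrite /half_width.
have [x Lx <-] := p_high_attained u cL L0.
have [y Ly <-] := p_low_attained u cL L0.
have := le_p_high u cS (LS _ Lx); have := ge_p_low u cS (LS _ Ly); lra.
Qed.

(* Joining a point [T] above the cutting line to the point of [L] that is
   extreme in direction [e] crosses the line at a point that is still [D]-close
   to [T] in direction [e]. *)
Lemma crossing_point {R : realType} (S L : set (R * R)) (u e T : R * R) m :
  compact S -> convex2 S -> compact L -> L !=set0 -> L `<=` S ->
  (forall x, L x -> dot u x <= m) -> S T -> m <= dot u T ->
  exists C, [/\ S C, dot u C = m &
    dot e T - dot e C <= 2 * (half_width S e - half_width L e)].
Proof.
move=> cS vS cL L0 LS Lm ST mT.
have [A LA eA] := p_high_attained e cL L0.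
have [B LB eB] := p_low_attained e cL L0.
have [s /andP[s0 s1] sm] : exists2 s, 0 <= s <= 1 &
    (1 - s) * dot u T + s * dot u A = m.
  have [Tm|Tm] := leP (dot u T) m.
    by exists 0; rewrite ?lexx ?ler01//; lra.
  have Am := Lm _ LA.
  have d0 : 0 < dot u T - dot u A by lra.
  exists ((dot u T - m) / (dot u T - dot u A)).
    by rewrite divr_ge0 ?ler_pdivrMr//=; lra.
  by field; lra.
exists (between s T A); split; rewrite ?dot_between//.
  by apply: vS => //; [exact: LS | rewrite s0].
(* The loss [s * (dot e T - dot e A)] is at most the drop of [p_high]; adding the rise of [p_low],
   which is nonnegative, gives twice the drop of the half-width. *)
have := le_p_high e cS ST; have := ge_p_low e cS (LS _ LB).
have := le_p_high e cS (LS _ LA); rewrite /half_width eA eB.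
nra.
Qed.

(* Multiplying [p - q] by the normal [(-s, c)] gives
   [w * (c ^+ 2 - c * s + s ^+ 2) <= c * D1 + s * D2], and
   [c ^+ 2 - c * s + s ^+ 2 >= 1 / 2]. *)
Lemma drop_bound {R : realType} (c s w D1 D2 p1 p2 q1 q2 : R) :
  0 <= c -> 0 <= s -> c ^+ 2 + s ^+ 2 = 1 -> 0 <= D1 -> 0 <= D2 -> 0 <= w ->
  c * p1 + s * p2 = w -> c * q1 + s * q2 = w ->
  (p1 - q1) ^+ 2 + (p2 - q2) ^+ 2 <= w ^+ 2 ->
  p1 <= D1 -> q2 <= D2 -> w <= 2 * (D1 + D2).
Proof.
move=> c0 s0 cs1 D10 D20 w0 pw qw pq p1D q2D.
have c1 : c <= 1 by nra.
have s1 : s <= 1 by nra.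
(* In the orthonormal frame [(c, s)], [(- s, c)] both points have first coordinate [w], and [a], [b]
   are their second coordinates. *)
pose a := - s * p1 + c * p2; pose b := - s * q1 + c * q2.
have p1E : p1 = c * w - s * a.
  by rewrite -[LHS]mul1r -cs1 -pw /a; ring.
have q2E : q2 = s * w + c * b.
  by rewrite -[LHS]mul1r -cs1 -qw /b; ring.
have abw : (a - b) ^+ 2 <= w ^+ 2.
  apply: le_trans pq.
  have -> : (p1 - q1) ^+ 2 + (p2 - q2) ^+ 2 =
    (a - b) ^+ 2 + (c * (p1 - q1) + s * (p2 - q2)) ^+ 2.
    by rewrite -[LHS]mul1r -cs1 /a /b; ring.
  by rewrite lerDl sqr_ge0.
have abw' : a - b <= w.
  apply: le_trans (ler_norm _) _.
  by rewrite -(ger0_norm w0) -ler_sqr ?nnegrE// !real_normK ?num_real.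
have csh : c * s <= 1 / 2 by have := sqr_ge0 (c - s); nra.
(* As [c] and [s] are at most 1, adding [h1] and [h2] gives [w - c * s * (a - b) <= D1 + D2]. *)
have h1 : c * (c * w - s * a) <= D1 by rewrite -p1E; nra.
have h2 : s * (s * w + c * b) <= D2 by rewrite -q2E; nra.
have h3 : c * s * (a - b) <= c * s * w by rewrite ler_wpM2l// mulr_ge0.
have h4 : w * (c * s) <= w * (1 / 2) by rewrite ler_wpM2l.
have h5 : (c ^+ 2 + s ^+ 2) * w = w by rewrite cs1 mul1r.
nra.
Qed.

(** From a highest point [T], [crossing_point] yields [C] and [D] on the cut that hardly recede from
    [T] horizontally, respectively vertically, unless the box shrinks. Were both recessions too
    small, [C] and [D] would be farther apart than [chord] allows; [drop_bound] quantifies this. *)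
Lemma box_width_drop {R : realType} (S L : set (R * R)) u :
  u.1 ^+ 2 + u.2 ^+ 2 = 1 -> compact S -> convex2 S ->
  (forall C D, S C -> S D -> dot u C = p_mid S u -> dot u D = p_mid S u ->
    (C.1 - D.1) ^+ 2 + (C.2 - D.2) ^+ 2 <= half_width S u ^+ 2) ->
  compact L -> L !=set0 -> L `<=` lower_part S u (p_mid S u) ->
  half_width S u <= 2 * (box_width S - box_width L).
Proof.
move=> u1 cS vS chord cL L0 LSm.
have LS : L `<=` S by move=> x /LSm[].
have Lm x : L x -> dot u x <= p_mid S u by move=> /LSm[].
have S0 : S !=set0 by case: L0 => x /LS; exists x.
have [T ST Tu] := p_high_attained u cS S0.
have w0 : 0 <= half_width S u.
  by have := ge_p_low u cS ST; rewrite Tu /half_width; lra.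
have Tw : dot u T = p_mid S u + half_width S u.
  by rewrite Tu /p_mid /half_width; lra.
have mT : p_mid S u <= dot u T by rewrite Tw; lra.
(* Reflecting the axes makes the entries of [u] nonnegative, as [drop_bound] requires. Giving 0 the
   sign 1 keeps [sg x ^+ 2 = 1] for all [x]. *)
pose sg (x : R) : R := if 0 <= x then 1 else - 1.
have sg0 x : 0 <= sg x * x by rewrite /sg; case: ifPn; rewrite -?ltNge; lra.
have sg2 x : sg x ^+ 2 = 1 by rewrite /sg; case: ifP => _; ring.
have hw1 A : half_width A (sg u.1, 0) = half_width A (1, 0).
  rewrite /sg; case: ifP => // _.
  by rewrite -half_width_opp2 /opp2/= opprK oppr0.
have hw2 A : half_width A (0, sg u.2) = half_width A (0, 1).
  rewrite /sg; case: ifP => // _.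
  by rewrite -half_width_opp2 /opp2/= opprK oppr0.
have [C [SC Cm CD]] := crossing_point (sg u.1, 0) cS vS cL L0 LS Lm ST mT.
have [D [SD Dm DD]] := crossing_point (0, sg u.2) cS vS cL L0 LS Lm ST mT.
have CDw := chord _ _ SC SD Cm Dm.
have H1 := half_width_subset (1, 0) cS cL L0 LS.
have H2 := half_width_subset (0, 1) cS cL L0 LS.
rewrite !hw1 in CD; rewrite !hw2 in DD.
have -> : box_width S - box_width L =
  2 * (half_width S (1, 0) - half_width L (1, 0)) +
  2 * (half_width S (0, 1) - half_width L (0, 1)).
  by rewrite /box_width; ring.
move: CD DD Cm Dm Tw; rewrite /dot/= => CD DD Cm Dm Tw.
apply: (@drop_bound _ (sg u.1 * u.1) (sg u.2 * u.2) _ _ _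
  (sg u.1 * (T.1 - C.1)) (sg u.2 * (T.2 - C.2))
  (sg u.1 * (T.1 - D.1)) (sg u.2 * (T.2 - D.2))) => //.
- by rewrite !exprMn !sg2 !mul1r.
- lra.
- lra.
- transitivity (sg u.1 ^+ 2 * (u.1 * (T.1 - C.1)) +
      sg u.2 ^+ 2 * (u.2 * (T.2 - C.2))).
    by ring.
  rewrite !sg2; lra.
- transitivity (sg u.1 ^+ 2 * (u.1 * (T.1 - D.1)) +
      sg u.2 ^+ 2 * (u.2 * (T.2 - D.2))).
    by ring.
  rewrite !sg2; lra.
- apply: le_trans CDw; rewrite le_eqVlt; apply/orP; left; apply/eqP.
  transitivity (sg u.1 ^+ 2 * ((C.1 - D.1) ^+ 2) +
      sg u.2 ^+ 2 * ((C.2 - D.2) ^+ 2)).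
    by ring.
  by rewrite !sg2 !mul1r.
- lra.
- lra.
Qed.

(** * Integrals of affine functions and areas of cut sets *)

Lemma integral_affine (R : realType) (c d l r : R) : l <= r ->
  (\int[lebesgue_measure]_(x in `[l, r]) (c * x + d)%:E =
   (c / 2 * (r ^+ 2 - l ^+ 2) + d * (r - l))%:E)%E.
Proof.
rewrite le_eqVlt => /orP[/eqP <-|lr].
  by rewrite set_itv1 integral_set1 !subrr !mulr0 addr0.
pose F (x : R) : R := c / 2 * x ^+ 2 + d * x.
have dF (x : R) : is_derive x 1 F (c * x + d).
  have -> : c * x + d = c / 2 *: (x *+ 2) + d *: 1.
    by rewrite /GRing.scale/= -mulr_natl; field.
  have h : is_derive x 1 (fun y : R => y ^+ 2) (x *+ 2).
    by apply: is_derive_eq; rewrite /GRing.scale/=; ring.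
  exact: is_deriveD.
have cF : continuous F.
  by move=> x; apply: differentiable_continuous; apply/derivable1_diffP.
rewrite (@continuous_FTC2 _ _ F)//.
- by rewrite -EFinB /F; congr EFin; ring.
- apply: continuous_subspaceT => x; apply: cvgD; last exact: cvg_cst.
  by apply: cvgM; [exact: cvg_cst | exact: cvg_id].
- split => [x _||]; first exact: (@ex_derive _ _ _ _ _ _ _ (dF x)).
  + by apply: cvg_at_right_filter; exact: cF.
  + by apply: cvg_at_left_filter; exact: cF.
- by move=> x _; rewrite derive1E; apply: derive_val.
Qed.

Lemma measurable_dot (R : realType) (u : R * R) :
  measurable_fun [set: R * R] (dot u).
Proof.
apply: measurable_funD; apply: measurable_funM => //.
Qed.

Lemma measurable_line (R : realType) (u : R * R) p :
  measurable [set x : R * R | dot u x = p].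
Proof.
rewrite -[X in measurable X]setTI.
exact: (measurable_dot u measurableT (measurable_set1 p)).
Qed.

Lemma measurable_lower_part (R : realType) (S : set (R * R)) u p :
  measurable S -> measurable (lower_part S u p).
Proof.
move=> mS.
have -> : lower_part S u p = S `&` ([set: R * R] `&` dot u @^-1` `]-oo, p]).
  by rewrite setTI; apply/seteqP; split => x; rewrite /lower_part/= in_itv.
apply: measurableI => //.
exact: (measurable_dot u measurableT (measurable_itv _)).
Qed.

Lemma measurable_upper_part (R : realType) (S : set (R * R)) u p :
  measurable S -> measurable (upper_part S u p).
Proof. by rewrite upper_part_opp2; exact: measurable_lower_part. Qed.

Lemma unit_square_setX (R : realType) :
  unit_square (R := R) = `[0, 1] `*` `[0, 1].
Proof.
apply/seteqP; split => [x []|x []] /=; rewrite !in_itv/=.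
  by move=> -> -> -> ->.
by move=> /andP[? ?] /andP[? ?].
Qed.

Lemma measurable_unit_square (R : realType) : measurable (unit_square (R := R)).
Proof. by rewrite unit_square_setX; exact: measurableX. Qed.

Lemma area_unit_square (R : realType) : area (unit_square (R := R)) = 1%E.
Proof.
rewrite unit_square_setX.
have e : lebesgue_measure (`[0, 1] : set R) = 1%E.
  by rewrite lebesgue_measure_itv/= lte_fin ltr01 sube0.
rewrite /area product_measure1E// -[RHS]mule1.
by congr (_ * _)%E; exact: e.
Qed.

(** A vertical line is the product of a point with the whole axis, of measure [0 * oo = 0]; any
    other line has single points as vertical sections. *)
Lemma area_line (R : realType) (u : R * R) p :
  u.1 ^+ 2 + u.2 ^+ 2 = 1 -> area [set x | dot u x = p] = 0%E.
Proof.
move=> u1; have [u20|u20] := eqVneq u.2 0.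
  have u10 : u.1 != 0.
    by apply/eqP => h; move: u1; rewrite h u20; lra.
  have -> : [set x | dot u x = p] = [set p / u.1] `*` setT.
    apply/seteqP; split => [x /=|x [/= + _]]; rewrite /dot u20 mul0r addr0.
      by move=> <-; split => //=; field.
    by move=> ->; field.
  rewrite /area product_measure1E//.
  by rewrite [X in (X * _)%E]lebesgue_measure_set1 mul0e.
rewrite /area /product_measure1; apply: integral0_eq => x _ /=.
have -> : xsection [set y | dot u y = p] x = [set (p - u.1 * x) / u.2].
  apply/seteqP; split => y; rewrite /xsection/= ?inE/dot/=.
    by move=> <-; field.
  by move=> ->; field.
exact: lebesgue_measure_set1.
Qed.

Lemma le_area (R : realType) (A B : set (R * R)) :
  measurable A -> measurable B -> A `<=` B -> (area A <= area B)%E.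
Proof. by move=> mA mB AB; rewrite /area le_measure ?inE. Qed.

(** The parts overlap only in the cutting line, a null set; removing it from the upper part makes
    the union disjoint. *)
Lemma area_split (R : realType) (S : set (R * R)) u p :
  measurable S -> u.1 ^+ 2 + u.2 ^+ 2 = 1 ->
  (area S = area (upper_part S u p) + area (lower_part S u p))%E.
Proof.
move=> mS u1.
have mU : measurable (upper_part S u p) by exact: measurable_upper_part.
have mL : measurable (lower_part S u p) by exact: measurable_lower_part.
have mA : measurable (upper_part S u p `\` [set x | dot u x = p]).
  by apply: measurableD => //; exact: measurable_line.
have mN : measurable (upper_part S u p `&` [set x | dot u x = p]).
  by apply: measurableI => //; exact: measurable_line.
have N0 : area (upper_part S u p `&` [set x | dot u x = p]) = 0%E.
  apply/eqP; rewrite eq_le; apply/andP; split.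
    rewrite -(area_line p u1); apply: le_area => //; exact: measurable_line.
  exact: measure_ge0.
have UE : area (upper_part S u p) =
    area (upper_part S u p `\` [set x | dot u x = p]).
  rewrite -[in LHS](setDUK (A := upper_part S u p `&` [set x | dot u x = p])
    (B := upper_part S u p)); last exact: subIsetl.
  rewrite setDIr setDv set0U setUC.
  by rewrite [LHS]measureU0.
rewrite UE.
rewrite [in LHS](_ : S = (upper_part S u p `\` [set x | dot u x = p]) `|`
    lower_part S u p); last first.
  apply/seteqP; split => [x Sx|x [[[]]|[]]]//.
  have [xp|px] := leP (dot u x) p; [by right|left; split].
    by split => //; exact: ltW.
  by move=> /= h; rewrite h ltxx in px.
rewrite {1}/area [LHS]measureU//; last first.
  apply/seteqP; split => // x [[[_ /= px] ne] [_ /= xp]].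
  by apply: ne; apply/eqP; rewrite eq_le xp px.
Qed.

(** * Vertical sections and the area of triangles *)

Lemma section_length (R : realType) (S : set (R * R)) (x y z : R) :
  measurable S -> convex2 S -> S (x, y) -> S (x, z) ->
  (`|z - y|%:E <= lebesgue_measure (xsection S x))%E.
Proof.
move=> mS vS.
wlog yz : y z / y <= z.
  by move=> H Sy Sz; have [/H|/ltW /H] := leP y z; [|rewrite distrC]; exact.
move=> Sy Sz; rewrite ger0_norm ?subr_ge0//.
have -> : (z - y)%:E = lebesgue_measure `[y, z].
  rewrite lebesgue_measure_itv/= lte_fin; case: ltP => //.
  by move=> zy; congr EFin; lra.
apply: le_measure; rewrite ?inE//; first exact: measurable_xsection.
move=> t /=; rewrite in_itv/= => /andP[yt tz]; rewrite /xsection/= inE.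
have [yz'|yz'] := leP z y.
  by have -> : t = y by lra.
have d : 0 < z - y by lra.
have -> : (x, t) = between ((t - y) / (z - y)) (x, y) (x, z).
  by rewrite /between/=; congr pair; field; lra.
by apply: vS => //; rewrite divr_ge0 ?ler_pdivrMr//; lra.
Qed.

Lemma measurable_section_length (R : realType) (S : set (R * R)) (D : set R) :
  measurable S -> measurable D ->
  measurable_fun D (fun x => lebesgue_measure (xsection S x)).
Proof.
move=> mS mD; apply: (measurable_funS measurableT) => //.
exact: (measurable_fun_xsection (@lebesgue_measure R) mS).
Qed.

(** The left side is the integral of [c * x + d]. By convexity two far enough points in each section
    suffice, so sections need not be computed. *)
Lemma affine_sections (R : realType) (S : set (R * R)) (c d l r : R) :
  measurable S -> convex2 S -> l <= r ->
  (forall x, l <= x <= r -> 0 <= c * x + d) ->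
  (forall x, l <= x <= r ->
    exists y z, [/\ S (x, y), S (x, z) & c * x + d <= `|z - y|]) ->
  ((c / 2 * (r ^+ 2 - l ^+ 2) + d * (r - l))%:E <=
   \int[lebesgue_measure]_(x in `[l, r]) lebesgue_measure (xsection S x))%E.
Proof.
move=> mS vS lr pos sec; rewrite -integral_affine//.
have mf : measurable_fun (`[l, r] : set R) (fun x : R => (c * x + d)%:E).
  have h : measurable_fun (`[l, r] : set R) (fun x : R => c * x + d).
    exact: measurable_funD.
  exact/measurable_EFinP.
apply: ge0_le_integral => //.
- exact: measurable_section_length.
- move=> x; rewrite /= in_itv/= => /sec[y [z [Sy Sz h]]].
  by apply: le_trans (section_length mS vS Sy Sz); rewrite lee_fin.
Qed.

(** Twice the signed area of the triangle, as the determinant of two edge vectors. *)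
Definition signed_area2 (R : realType) (a b c : R * R) : R :=
  (b.1 - a.1) * (c.2 - a.2) - (b.2 - a.2) * (c.1 - a.1).

(** The vertical through the middle vertex [b] meets the triangle in a chord of length [L]. Section
    lengths rise linearly from 0 at [a] to [L], then fall linearly to 0 at [c], and the sections of
    [S] are at least as long. *)
Lemma triangle_area_sorted (R : realType) (S : set (R * R)) a b c :
  measurable S -> convex2 S -> S a -> S b -> S c ->
  a.1 <= b.1 <= c.1 -> ((`|signed_area2 a b c| / 2)%:E <= area S)%E.
Proof.
move=> mS vS Sa Sb Sc /andP[ab bc].
have [ca|ac] := leP c.1 a.1.
  have -> : signed_area2 a b c = 0.
    rewrite /signed_area2; have -> : b.1 = a.1 by lra.
    have -> : c.1 = a.1 by lra.
    ring.
  by rewrite normr0 mul0r /area measure_ge0.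
pose s := (b.1 - a.1) / (c.1 - a.1).
have s01 : 0 <= s <= 1 by rewrite /s divr_ge0 ?ler_pdivrMr//=; lra.
have [e [Se e1 e2]] : exists e, [/\ S e, e.1 = b.1 &
    e.2 = (1 - s) * a.2 + s * c.2].
  exists (between s a c); split; rewrite //=; first exact: vS.
  by rewrite /s; field; lra.
pose L := `|e.2 - b.2|.
have L0 : 0 <= L by exact: normr_ge0.
have LE : `|signed_area2 a b c| = L * (c.1 - a.1).
  rewrite /L -[X in _ * X]ger0_norm; last by lra.
  rewrite -normrM /signed_area2 e2 /s; congr (`| _ |); field; lra.
have left_part : ((L * (b.1 - a.1) / 2)%:E <=
    \int[lebesgue_measure]_(x in `[a.1, b.1]) lebesgue_measure (xsection S x))%E.
  have [ba|{}ab] := leP b.1 a.1.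
    have -> : b.1 - a.1 = 0 by lra.
    by rewrite mulr0 mul0r; apply: integral_ge0.
  have d : 0 < b.1 - a.1 by lra.
  pose k := L / (b.1 - a.1).
  have k0 : 0 <= k by rewrite divr_ge0// ltW.
  have -> : L * (b.1 - a.1) / 2 =
      k / 2 * (b.1 ^+ 2 - a.1 ^+ 2) + (- k * a.1) * (b.1 - a.1).
    by rewrite /k; field; lra.
  apply: affine_sections => //; first exact: ltW.
    by move=> x /andP[ax xb]; nra.
  move=> x /andP[ax xb]; pose t := (x - a.1) / (b.1 - a.1).
  have t01 : 0 <= t <= 1 by rewrite /t divr_ge0 ?ler_pdivrMr//=; lra.
  exists (between t a b).2, (between t a e).2; split.
  - have <- : between t a b = (x, (between t a b).2).
      by rewrite /between/= /t; congr pair; field; lra.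
    exact: vS.
  - have <- : between t a e = (x, (between t a e).2).
      by rewrite /between/= e1 /t; congr pair; field; lra.
    exact: vS.
  - have -> : (between t a e).2 - (between t a b).2 = t * (e.2 - b.2).
      by rewrite /between/=; ring.
    rewrite normrM (ger0_norm (x := t)); last by lra.
    rewrite -/L /k /t le_eqVlt; apply/orP; left; apply/eqP; field; lra.
have right_part : ((L * (c.1 - b.1) / 2)%:E <=
    \int[lebesgue_measure]_(x in `[b.1, c.1]) lebesgue_measure (xsection S x))%E.
  have [cb|{}bc] := leP c.1 b.1.
    have -> : c.1 - b.1 = 0 by lra.
    by rewrite mulr0 mul0r; apply: integral_ge0.
  have d : 0 < c.1 - b.1 by lra.
  pose k := L / (c.1 - b.1).
  have k0 : 0 <= k by rewrite divr_ge0// ltW.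
  have -> : L * (c.1 - b.1) / 2 =
      (- k) / 2 * (c.1 ^+ 2 - b.1 ^+ 2) + (k * c.1) * (c.1 - b.1).
    by rewrite /k; field; lra.
  apply: affine_sections => //; first exact: ltW.
    by move=> x /andP[bx xc]; nra.
  move=> x /andP[bx xc]; pose t := (c.1 - x) / (c.1 - b.1).
  have t01 : 0 <= t <= 1 by rewrite /t divr_ge0 ?ler_pdivrMr//=; lra.
  exists (between t c b).2, (between t c e).2; split.
  - have <- : between t c b = (x, (between t c b).2).
      by rewrite /between/= /t; congr pair; field; lra.
    exact: vS.
  - have <- : between t c e = (x, (between t c e).2).
      by rewrite /between/= e1 /t; congr pair; field; lra.
    exact: vS.
  - have -> : (between t c e).2 - (between t c b).2 = t * (e.2 - b.2).
      by rewrite /between/=; ring.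
    rewrite normrM (ger0_norm (x := t)); last by lra.
    rewrite -/L /k /t le_eqVlt; apply/orP; left; apply/eqP; field; lra.
(* The second interval omits [b.1] to make the two pieces disjoint; this does not change its
   integral. *)
apply: (@le_trans _ _ (\int[lebesgue_measure]_(x in `[a.1, b.1] `|` `]b.1, c.1])
    lebesgue_measure (xsection S x))%E); last first.
  rewrite /area /product_measure1; apply: ge0_subset_integral => //.
  - exact: measurableU.
  - exact: measurable_section_length.
rewrite ge0_integral_setU//=; last 2 first.
- by apply: measurable_section_length => //; exact: measurableU.
- rewrite disj_set2E; apply/eqP/seteqP; split => // x [] /=.
  by rewrite !in_itv/= => /andP[_ xb] /andP[/lt_le_trans /(_ xb)]; rewrite ltxx.
rewrite integral_itv_obnd_cbnd; last exact: measurable_section_length.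
have -> : `|signed_area2 a b c| / 2 = L * (b.1 - a.1) / 2 + L * (c.1 - b.1) / 2.
  by rewrite LE; ring.
by rewrite EFinD leeD.
Qed.

(** A cyclic shift of the vertices keeps the determinant and a swap only flips its sign, so they may
    be sorted by first coordinate. *)
Lemma triangle_area (R : realType) (S : set (R * R)) a b c :
  measurable S -> convex2 S -> S a -> S b -> S c ->
  ((`|signed_area2 a b c| / 2)%:E <= area S)%E.
Proof.
move=> mS vS Sa Sb Sc.
have cyc x y z : signed_area2 x y z = signed_area2 y z x.
  by rewrite /signed_area2; ring.
have swp x y z : `|signed_area2 x y z| = `|signed_area2 x z y|.
  by rewrite -normrN /signed_area2; congr (`| _ |); ring.
have [ab|/ltW ab] := leP a.1 b.1; have [bc|/ltW bc] := leP b.1 c.1;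
  have [ac|/ltW ac] := leP a.1 c.1.
- by apply: triangle_area_sorted; rewrite ?ab.
- by apply: triangle_area_sorted; rewrite ?ab.
- by rewrite swp; apply: triangle_area_sorted; rewrite ?ac.
- by rewrite -cyc; apply: triangle_area_sorted; rewrite ?ac ?ab.
- by rewrite cyc swp; apply: triangle_area_sorted; rewrite ?ab ?ac.
- by rewrite cyc; apply: triangle_area_sorted; rewrite ?bc ?ac.
- by rewrite swp cyc; apply: triangle_area_sorted; rewrite ?bc ?ab.
- by rewrite swp cyc; apply: triangle_area_sorted; rewrite ?bc ?ab.
Qed.

(** * Nondegenerate sets *)

(** For convex sets this amounts to a nonempty interior; explicit points are easy to carry through a
    homothety. *)
Definition fat (R : realType) (S : set (R * R)) : Prop :=
  exists a b c, [/\ S a, S b, S c & signed_area2 a b c != 0].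

(** With zero width, both edge vectors of the triangle are orthogonal to [u], so their determinant
    vanishes. *)
Lemma fat_width (R : realType) (S : set (R * R)) u :
  u.1 ^+ 2 + u.2 ^+ 2 = 1 -> compact S -> fat S -> p_low S u < p_high S u.
Proof.
move=> u1 cS [a [b [c [Sa Sb Sc /eqP]]]]; rewrite ltNge => abc.
apply/negP => hl; apply: abc.
have on_line x : S x -> dot u x = p_high S u.
  by move=> Sx; have := le_p_high u cS Sx; have := ge_p_low u cS Sx; lra.
have ab : dot u a = dot u b by rewrite !on_line.
have ac : dot u a = dot u c by rewrite !on_line.
have e1 : u.1 * (b.1 - a.1) = - u.2 * (b.2 - a.2).
  by move: ab; rewrite /dot; lra.
have e2 : u.1 * (c.1 - a.1) = - u.2 * (c.2 - a.2).
  by move: ac; rewrite /dot; lra.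
have f1 : u.1 * signed_area2 a b c = 0.
  transitivity (u.1 * (b.1 - a.1) * (c.2 - a.2) -
      (b.2 - a.2) * (u.1 * (c.1 - a.1))).
    by rewrite /signed_area2; ring.
  by rewrite e1 e2; ring.
have f2 : u.2 * signed_area2 a b c = 0.
  transitivity ((b.1 - a.1) * - (- u.2 * (c.2 - a.2)) +
      (- u.2 * (b.2 - a.2)) * (c.1 - a.1)).
    by rewrite /signed_area2; ring.
  by rewrite -e1 -e2; ring.
(* Expanding 1 as [u.1 ^+ 2 + u.2 ^+ 2] avoids dividing by an entry of [u], which may be 0. *)
rewrite -[LHS]mul1r -u1.
transitivity (u.1 * (u.1 * signed_area2 a b c) +
    u.2 * (u.2 * signed_area2 a b c)); first by ring.
by rewrite f1 f2; ring.
Qed.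

Lemma fat_area (R : realType) (S : set (R * R)) :
  measurable S -> convex2 S -> fat S -> (0 < area S)%E.
Proof.
move=> mS vS [a [b [c [Sa Sb Sc abc]]]].
apply: lt_le_trans (triangle_area mS vS Sa Sb Sc).
by rewrite lte_fin divr_gt0// normr_gt0.
Qed.

(* The part of [S] below the cut contains a homothetic copy of [S], centred at
   a lowest point. *)
Lemma fat_lower_part (R : realType) (S : set (R * R)) u p :
  compact S -> convex2 S -> fat S ->
  p_low S u < p <= p_high S u -> fat (lower_part S u p).
Proof.
move=> cS vS [a [b [c [Sa Sb Sc abc]]]] /andP[lp ph].
have [z Sz zE] : exists2 z, S z & dot u z = p_low S u.
  by apply: p_low_attained => //; exists a.
(* With this ratio the homothety fixes the height [p_low S u] and sends [p_high S u] to [p]. *)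
pose s := (p - p_low S u) / (p_high S u - p_low S u).
have s0 : 0 < s by rewrite /s divr_gt0; lra.
have s1 : s <= 1 by rewrite /s ler_pdivrMr; lra.
have sE : s * (p_high S u - p_low S u) = p - p_low S u by rewrite /s; field; lra.
have low x : S x -> lower_part S u p (between s z x).
  move=> Sx; split; first by apply: vS => //; rewrite ltW.
  rewrite /= dot_between zE; have := le_p_high u cS Sx; nra.
exists (between s z a), (between s z b), (between s z c); split; try exact: low.
have -> : signed_area2 (between s z a) (between s z b) (between s z c) =
    s ^+ 2 * signed_area2 a b c.
  by rewrite /signed_area2 /between/=; ring.
by rewrite mulf_neq0// expf_neq0// gt_eqF.
Qed.

(** * Chords and triangles standing on them *)

(** The slice is compact and convex; its endpoints are the extreme points along the tangent [n]. *)
Lemma segment_line (R : realType) (S : set (R * R)) u m :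
  u.1 ^+ 2 + u.2 ^+ 2 = 1 -> compact S -> convex2 S ->
  S `&` [set x | dot u x = m] !=set0 ->
  exists a b, S `&` [set x | dot u x = m] = segment a b.
Proof.
move=> u1 cS vS L0; pose L := S `&` [set x | dot u x = m].
pose n : R * R := (- u.2, u.1).
have cL : compact L.
  have -> : L = upper_part (lower_part S u m) u m.
    apply/seteqP; split => [x [Sx /= xm]|x [[Sx /= xm] mx]].
      by split; [split|]; rewrite //= xm.
    by split => //=; apply/eqP; rewrite eq_le xm.
  exact/compact_upper_part/compact_lower_part.
have [a [Sa am] amin] := p_low_min n cL L0.
have [b [Sb bm] bmax] := p_high_max n cL L0.
exists a, b; apply/seteqP; split => [x [Sx /= xm]|_ [s s01 <-]].
  have Lx : L x by [].
  (* In the orthonormal frame [u], [n], a point of the line is determined by its [n]-coordinate. *)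
  have xE (y : R * R) : dot u y = m ->
      y = (u.1 * m - u.2 * dot n y, u.2 * m + u.1 * dot n y).
    move=> <-; rewrite [LHS]surjective_pairing; congr pair.
      by rewrite -[LHS]mul1r -u1 /dot/=; ring.
    by rewrite -[LHS]mul1r -u1 /dot/=; ring.
  (* Treating the end [b] apart also covers a chord reduced to a point, where the quotient [s] would
     be [0 / 0]. *)
  have := amin _ Lx; have := bmax _ Lx; rewrite le_eqVlt => /orP[/eqP xb _|xb ax].
    exists 1; first by rewrite /= in_itv/= ler01 lexx.
    rewrite subrr !mul0r !add0r !mul1r -surjective_pairing.
    by rewrite (xE b)// (xE x)// xb.
  pose s := (dot n x - dot n a) / (dot n b - dot n a).
  have xab : dot n x = (1 - s) * dot n a + s * dot n b by rewrite /s; field; lra.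
  have [a1 a2] : a.1 = u.1 * m - u.2 * dot n a /\ a.2 = u.2 * m + u.1 * dot n a.
    by split; rewrite [in LHS](xE a).
  have [b1 b2] : b.1 = u.1 * m - u.2 * dot n b /\ b.2 = u.2 * m + u.1 * dot n b.
    by split; rewrite [in LHS](xE b).
  exists s; first by rewrite /= in_itv/= /s divr_ge0 ?ler_pdivrMr//; lra.
  by rewrite [RHS](xE x)// xab a1 a2 b1 b2; congr pair; ring.
split; first by apply: vS => //; move: s01; rewrite /= in_itv.
by rewrite /= [LHS]dot_between am bm; ring.
Qed.

Lemma segment_dist (R : realType) (a b x y : R * R) :
  segment a b x -> segment a b y ->
  (x.1 - y.1) ^+ 2 + (x.2 - y.2) ^+ 2 <= enorm (b.1 - a.1, b.2 - a.2) ^+ 2.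
Proof.
move=> [s s01 <-] [t t01 <-] /=; move: s01 t01.
rewrite /= !in_itv/= => /andP[s0 s1] /andP[t0 t1].
rewrite sqr_sqrtr; last by rewrite addr_ge0 ?sqr_ge0.
set d := dot _ _.
have -> : ((1 - s) * a.1 + s * b.1 - ((1 - t) * a.1 + t * b.1)) ^+ 2 +
    ((1 - s) * a.2 + s * b.2 - ((1 - t) * a.2 + t * b.2)) ^+ 2 = (s - t) ^+ 2 * d.
  by rewrite /d /dot/=; ring.
have d0 : 0 <= d by rewrite addr_ge0 ?sqr_ge0.
rewrite ler_piMl//; nra.
Qed.

(** An edge orthogonal to [u] is [k] times the unit vector [(- u.2, u.1)], so up to sign the
    determinant is [k] times the height. *)
Lemma triangle_base_height (R : realType) (u a b x : R * R) :
  u.1 ^+ 2 + u.2 ^+ 2 = 1 -> dot u a = dot u b ->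
  `|signed_area2 a b x| = enorm (b.1 - a.1, b.2 - a.2) * `|dot u x - dot u a|.
Proof.
move=> u1 ab.
have {}ab : u.1 * (b.1 - a.1) + u.2 * (b.2 - a.2) = 0.
  by move: ab; rewrite /dot; lra.
pose k := u.1 * (b.2 - a.2) - u.2 * (b.1 - a.1).
have k1 : b.1 - a.1 = - k * u.2.
  rewrite -[LHS]mul1r -u1 -[RHS]addr0 -(mulr0 u.1) -ab /k; ring.
have k2 : b.2 - a.2 = k * u.1.
  rewrite -[LHS]mul1r -u1 -[RHS]addr0 -(mulr0 u.2) -ab /k; ring.
have -> : enorm (b.1 - a.1, b.2 - a.2) = `|k|.
  rewrite /enorm -sqrtr_sqr; congr Num.sqrt; rewrite /dot/= k1 k2.
  by rewrite -[RHS]mulr1 -u1; ring.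
rewrite -normrM -[RHS]normrN /signed_area2 k1 k2 /dot; congr (`| _ |); ring.
Qed.

(** * Chord, area and bisection for a single context *)

Section round.
Context {R : realType} (S : set (R * R)).
Hypotheses (cS : compact S) (vS : convex2 S) (mS : measurable S).
Hypotheses (fS : fat S) (unitS : S `<=` unit_square (R := R)).

Let S0 : S !=set0.
Proof. by case: fS => a [? [? []]]; exists a. Qed.

Lemma area_fin_num : area S \is a fin_num.
Proof.
rewrite ge0_fin_numE; last exact: measure_ge0.
apply: (@le_lt_trans _ _ (area (unit_square (R := R)))).
  by apply: le_area => //; exact: measurable_unit_square.
by rewrite area_unit_square ltry.
Qed.

Lemma half_width_ge0 u : 0 <= half_width S u.
Proof.
case: S0 => x Sx; rewrite /half_width.
by have := le_p_high u cS Sx; have := ge_p_low u cS Sx; lra.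
Qed.

Lemma box_width_ge0 : 0 <= box_width S.
Proof. by rewrite mulr_ge0// addr_ge0// half_width_ge0. Qed.

Section direction.
Variable u : R * R.
Hypothesis u1 : u.1 ^+ 2 + u.2 ^+ 2 = 1.

(** The midpoint of a highest and a lowest point lies on the middle line, so the slice is a genuine
    segment and [segment_length] does not return its default 0. *)
Lemma mid_chordP : exists a b,
  S `&` [set x | dot u x = p_mid S u] = segment a b /\
  mid_chord_length S u = enorm (b.1 - a.1, b.2 - a.2).
Proof.
have [t St tE] := p_high_attained u cS S0.
have [z Sz zE] := p_low_attained u cS S0.
have [|a [b abE]] := segment_line (m := p_mid S u) u1 cS vS.
  exists (between (1 / 2) t z); split.
    by apply: vS => //; apply/andP; split; lra.
  by rewrite /= dot_between tE zE /p_mid; field.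
have := @xgetPex _ 0 [set h | exists a b : R * R,
  S `&` [set x | dot u x = p_mid S u] = segment a b /\
  h = enorm (b.1 - a.1, b.2 - a.2)].
by apply; exists (enorm (b.1 - a.1, b.2 - a.2)), a, b.
Qed.

(* The middle chord and the two extreme points in direction [u] span a kite. *)
Lemma area_ge_chord_width :
  mid_chord_length S u * half_width S u <= fine (area S).
Proof.
have [a [b [abE ->]]] := mid_chordP.
have [t St tE] := p_high_attained u cS S0.
have [z Sz zE] := p_low_attained u cS S0.
have w0 := half_width_ge0 u.
have [Sa am] : (S `&` [set x | dot u x = p_mid S u]) a.
  rewrite abE; exists 0; first by rewrite /= in_itv/= lexx ler01.
  by rewrite subr0 !mul1r !mul0r !addr0 -surjective_pairing.
have [Sb bm] : (S `&` [set x | dot u x = p_mid S u]) b.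
  rewrite abE; exists 1; first by rewrite /= in_itv/= lexx ler01.
  by rewrite subrr !mul1r !mul0r !add0r -surjective_pairing.
have ab : dot u a = dot u b by rewrite am bm.
set h := enorm _.
(* Each part of [S] contains one half of the kite, a triangle whose base is the chord and whose
   height is the half-width. *)
have up : ((h * half_width S u / 2)%:E <= area (upper_part S u (p_mid S u)))%E.
  have -> : h * half_width S u = `|signed_area2 a b t|.
    rewrite (triangle_base_height t u1 ab) am tE -/h; congr (_ * _).
    by rewrite -[LHS]ger0_norm//; congr (`| _ |); rewrite /half_width /p_mid; field.
  apply: triangle_area; first exact: measurable_upper_part.
  - exact: convex2_upper_part.
  - by split => //=; rewrite am.
  - by split => //=; rewrite bm.
  - by split => //=; rewrite tE; move: w0; rewrite /half_width /p_mid; lra.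
have low : ((h * half_width S u / 2)%:E <= area (lower_part S u (p_mid S u)))%E.
  have -> : h * half_width S u = `|signed_area2 a b z|.
    rewrite (triangle_base_height z u1 ab) am zE -/h; congr (_ * _).
    rewrite -[LHS]ger0_norm// -[LHS]normrN; congr (`| _ |).
    by rewrite /half_width /p_mid; field.
  apply: triangle_area; first exact: measurable_lower_part.
  - exact: convex2_lower_part.
  - by split => //=; rewrite am.
  - by split => //=; rewrite bm.
  - by split => //=; rewrite zE; move: w0; rewrite /half_width /p_mid; lra.
rewrite -lee_fin fineK; last exact: area_fin_num.
rewrite (area_split (p_mid S u) mS u1).
have -> : h * half_width S u = h * half_width S u / 2 + h * half_width S u / 2.
  by field.
by rewrite EFinD leeD.
Qed.

(** A cut at or beyond an end of the range leaves one part inside a line, hence null. The other part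
    would then be null too, against [fat_area]. *)
Lemma bisection_inside p :
  area (upper_part S u p) = area (lower_part S u p) ->
  p_low S u < p < p_high S u.
Proof.
move=> half; have A0 := fat_area mS vS fS.
have mU := measurable_upper_part u p mS.
have mL := measurable_lower_part u p mS.
have line0 := area_line p u1.
have mline := measurable_line u p.
rewrite (area_split p mS u1) in A0.
apply/andP; split; rewrite ltNge; apply/negP => h.
- suff L0 : (area (lower_part S u p) <= 0)%E.
    by move: A0; rewrite half ltNge adde_le0.
  rewrite -line0; apply: le_area => // x [Sx /= xp].
  by have := ge_p_low u cS Sx; lra.
- suff U0 : (area (upper_part S u p) <= 0)%E.
    by move: A0; rewrite -half ltNge adde_le0.
  rewrite -line0; apply: le_area => // x [Sx /= xp].
  by have := le_p_high u cS Sx; lra.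
Qed.

End direction.
End round.

(** * The potential argument *)

(** The coefficient [4 + 2 * Num.sqrt 2] is [2 / (1 - 1 / Num.sqrt 2)]: halving the area [A] then
    releases exactly [2 * Num.sqrt A]. *)
Definition potential (R : realType) (S : set (R * R)) : R :=
  2 * box_width S + (4 + 2 * Num.sqrt 2) * Num.sqrt (fine (area S)).

Definition admissible (R : realType) (S : set (R * R)) : Prop :=
  [/\ compact S, convex2 S, measurable S, fat S & S `<=` unit_square (R := R)].

Lemma lower_round (R : realType) (S : set (R * R)) (u v : R * R) (p : R) :
  admissible S -> u.1 ^+ 2 + u.2 ^+ 2 = 1 -> symmetric_search_2d S u p ->
  lower_part S u p v ->
  admissible (lower_part S u p) /\
  p - dot u v <= potential S - potential (lower_part S u p).
Proof.
move=> [cS vS mS fS unitS] u1 rule [Sv vp].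
set L := lower_part S u p.
have cL : compact L by exact: compact_lower_part.
have vL : convex2 L by exact: convex2_lower_part.
have mL : measurable L by exact: measurable_lower_part.
have LS : L `<=` S by move=> x [].
have unitL : L `<=` unit_square (R := R) by move=> x /LS /unitS.
have L0 : L !=set0 by exists v.
have w0 := fat_width u1 cS fS.
(* Strictness at the lower end is what keeps the remaining part fat. *)
have inside : p_low S u < p < p_high S u.
  move: rule; rewrite /symmetric_search_2d; case: ifP => [_ ->|_].
    by rewrite /p_mid; apply/andP; split; lra.
  exact: bisection_inside.
have fL : fat L.
  by apply: fat_lower_part => //; case/andP: inside => -> /ltW.
split => //.
have vlow := ge_p_low u cS Sv.
have finS := area_fin_num mS unitS; have finL := area_fin_num mL unitL.
have boxSL : box_width L <= box_width S.
  have := half_width_subset (1, 0) cS cL L0 LS.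
  have := half_width_subset (0, 1) cS cL L0 LS.
  rewrite /box_width; lra.
have s2 : Num.sqrt 2 ^+ 2 = 2 :> R by rewrite sqr_sqrtr.
have s20 : 0 <= Num.sqrt 2 :> R by exact: sqrtr_ge0.
rewrite /potential.
move: rule; rewrite /symmetric_search_2d; case: ifPn => [hw pE|].
  have drop : half_width S u <= 2 * (box_width S - box_width L).
    apply: (box_width_drop u1 cS vS _ cL L0); last by rewrite /L pE.
    move=> C D SC SD Cm Dm.
    (* Both points lie on the middle chord, which in this branch is no longer than the
       half-width. *)
    have [a [b [abE hE]]] := mid_chordP cS vS fS u1.
    have Cab : segment a b C by rewrite -abE.
    have Dab : segment a b D by rewrite -abE.
    apply: le_trans (segment_dist Cab Dab) _; rewrite -hE.
    rewrite ler_sqr ?nnegrE//; first by rewrite hE sqrtr_ge0.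
    exact: half_width_ge0.
  have areaSL : Num.sqrt (fine (area L)) <= Num.sqrt (fine (area S)).
    by rewrite ler_wsqrtr// fine_le//; exact: le_area.
  have : p - dot u v <= half_width S u.
    by rewrite pE /p_mid /half_width; lra.
  nra.
rewrite -ltNge => wh half.
have w1 := half_width_ge0 cS fS u.
have areaS : fine (area S) = 2 * fine (area L).
  by rewrite (area_split p mS u1) half fineD// mulr2n mulrDl mul1r.
(* With [w] the half-width and [h] the chord, [w < h] gives [w ^+ 2 <= h * w], which the kite bounds
   by the area. *)
have widthS : half_width S u <= Num.sqrt (fine (area S)).
  rewrite -(ger0_norm w1) -sqrtr_sqr ler_wsqrtr//.
  apply: le_trans (area_ge_chord_width cS vS mS fS unitS u1).
  by rewrite expr2 ler_wpM2r// ltW.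
have sqrtS : Num.sqrt (fine (area S)) = Num.sqrt 2 * Num.sqrt (fine (area L)).
  by rewrite areaS sqrtrM.
have loss : p - dot u v <= 2 * half_width S u.
  by case/andP: inside; rewrite /half_width; lra.
(* This rests on [(4 + 2 * Num.sqrt 2) * (Num.sqrt 2 - 1) = 2 * Num.sqrt 2]. *)
have -> : 2 * box_width S + (4 + 2 * Num.sqrt 2) * Num.sqrt (fine (area S)) -
    (2 * box_width L + (4 + 2 * Num.sqrt 2) * Num.sqrt (fine (area L))) =
    2 * (box_width S - box_width L) + 2 * Num.sqrt (fine (area S)).
  rewrite sqrtS; set x := Num.sqrt (fine _); ring: s2.
lra.
Qed.

(** The middle line is the same point set for both contexts, so the chord test agrees; the area
    equation only swaps sides. *)
Lemma symmetric_search_opp2 (R : realType) (S : set (R * R)) u p :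
  symmetric_search_2d S u p -> symmetric_search_2d S (opp2 u) (- p).
Proof.
rewrite /symmetric_search_2d /mid_chord_length half_width_opp2 p_mid_opp2.
have -> : [set x | dot (opp2 u) x = - p_mid S u] = [set x | dot u x = p_mid S u].
  apply/seteqP; split => x /=; rewrite dot_opp2; first exact: oppr_inj.
  by move=> ->.
case: ifP => _; first by move=> ->.
by move=> half; rewrite -[in RHS]upper_part_opp2 half upper_part_opp2 opp2K opprK.
Qed.

(** An upper answer is a lower answer to the context [opp2 u] with guess [- p]. *)
Lemma round_bound (R : realType) (S : set (R * R)) (u v : R * R) (p : R) b
    (S' := if b then upper_part S u p else lower_part S u p) :
  admissible S -> u.1 ^+ 2 + u.2 ^+ 2 = 1 -> symmetric_search_2d S u p ->
  S v -> truthful v u p b ->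
  [/\ admissible S', S' v & `|dot u v - p| <= potential S - potential S'].
Proof.
move=> aS u1 rule Sv; rewrite /S' /truthful; case: b {S'} => vp.
- rewrite upper_part_opp2.
  have L : lower_part S (opp2 u) (- p) v by split; rewrite //= dot_opp2 lerN2.
  have ou1 : (opp2 u).1 ^+ 2 + (opp2 u).2 ^+ 2 = 1 by rewrite /= !sqrrN.
  have [aL] := lower_round aS ou1 (symmetric_search_opp2 rule) L.
  by rewrite dot_opp2 opprK addrC ger0_norm ?subr_ge0.
- have L : lower_part S u p v by [].
  have [aL] := lower_round aS u1 rule L.
  by rewrite distrC ger0_norm ?subr_ge0.
Qed.

Lemma admissible_unit_square (R : realType) :
  admissible (unit_square (R := R)).
Proof.
split => //.
- by rewrite unit_square_setX; apply: compact_setX; exact: segment_compact.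
- move=> a b s [a1 a2 a3 a4] [b1 b2 b3 b4] /andP[s0 s1].
  by split; rewrite /between/=; nra.
- exact: measurable_unit_square.
- exists (0, 0), (1, 0), (0, 1); split; try by split; rewrite /= ?lexx ?ler01.
  by rewrite /signed_area2/= !subr0 mulr1 mulr0 subr0 oner_neq0.
Qed.

Lemma potential_unit_square (R : realType) :
  potential (unit_square (R := R)) <= 8 + 2 * Num.sqrt 2.
Proof.
have [cS _ _ fS _] := admissible_unit_square R.
have S0 : unit_square (R := R) !=set0 by case: fS => a [? [? []]]; exists a.
have h1 : half_width (unit_square (R := R)) (1, 0) <= 1 / 2.
  have [x [? ? ? ?]] := p_high_attained (1, 0) cS S0.
  have [y [? ? ? ?]] := p_low_attained (1, 0) cS S0.
  by rewrite /half_width /dot/= => <- <-; lra.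
have h2 : half_width (unit_square (R := R)) (0, 1) <= 1 / 2.
  have [x [? ? ? ?]] := p_high_attained (0, 1) cS S0.
  have [y [? ? ? ?]] := p_low_attained (0, 1) cS S0.
  by rewrite /half_width /dot/= => <- <-; lra.
by rewrite /potential area_unit_square/= sqrtr1 /box_width; lra.
Qed.

Lemma potential_ge0 (R : realType) (S : set (R * R)) :
  admissible S -> 0 <= potential S.
Proof.
move=> [cS _ _ fS _].
apply: addr_ge0; apply: mulr_ge0; rewrite ?sqrtr_ge0 ?box_width_ge0//.
Qed.

Theorem theorem3 (R : realType) (T : nat) (v : R * R)
    (u : nat -> R * R) (p : nat -> R) (b : nat -> bool)
    (v_in : unit_square v)
    (u_unit : forall t, (t < T)%N -> enorm (u t) = 1)
    (p_rule : forall t, (t < T)%N ->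
       symmetric_search_2d (knowledge u p b t) (u t) (p t))
    (b_truthful : forall t, (t < T)%N -> truthful v (u t) (p t) (b t)) :
  \sum_(0 <= t < T) `|dot (u t) v - p t| <= 8 + 2 * Num.sqrt 2.
Proof.
pose K := knowledge u p b.
suff H t : (t <= T)%N -> [/\ admissible (K t), K t v &
    \sum_(0 <= i < t) `|dot (u i) v - p i| <= potential (K 0) - potential (K t)].
  have [/potential_ge0 KT _ sumT] := H T (leqnn T).
  apply: le_trans sumT (le_trans _ (potential_unit_square R)).
  by rewrite lerBlDr lerDl.
elim: t => [|t IH] tT.
  by split => //; [exact: admissible_unit_square | rewrite big_geq// subrr].
have [aK Kv sumK] := IH (ltnW tT).
have [aK' Kv' loss] : [/\ admissible (K t.+1), K t.+1 v &
    `|dot (u t) v - p t| <= potential (K t) - potential (K t.+1)].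
  exact: round_bound aK (enorm1E (u_unit _ tT)) (p_rule _ tT) Kv
    (b_truthful _ tT).
split=> [||]; [exact: aK' | exact: Kv' |].
have -> : \sum_(0 <= i < t.+1) `|dot (u i) v - p i| =
    \sum_(0 <= i < t) `|dot (u i) v - p i| + `|dot (u t) v - p t|.
  by rewrite big_nat_recr.
apply: le_trans (lerD sumK loss) _.
by move: (potential _) (potential _) (potential _) => x y z; rewrite addrA subrK.
Qed.
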